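(* Let $(X,d)$ be a finite metric space, let $N\ge 1$, and consider the greedy spatial matching process $(S^t)_{t\ge1}$ on $X^N$ described in the context, in which the user law $Q$ and the driver law $P$ satisfy $Q(\{u\})>0$ and $P(\{u\})>0$ for every $u\in X$. Let $c_t$ be the cost incurred at stage $t$. Then, for every initial tuple $S^1\in X^N$, the sequence $\mathbb{E}(c_t)$ converges as $t\to\infty$.
   Context: Greedy spatial matching process: $N$ vehicles (drivers) are located in $X$, with initial locations $S^1=(s^1_1,\dots,s^1_N)\in X^N$. Users arrive at random locations $(x_t)_{t\ge1}$, i.i.d. with law $Q$ on $X$, and new vehicles arrive at random locations $(y_t)_{t\ge1}$, i.i.d. with law $P$ on $X$; the two sequences are independent of each other. At every stage $t\in\{1,2,\dots\}$: (1) the user at $x_t$ is assigned to a closest vehicle, $k^*\in\operatorname{argmin}_{k=1,\dots,N} d(x_t,s^t_k)$ (ties are broken by some fixed rule depending only on $(S^t,x_t)$), and the cost is $c_t=d(x_t,s^t_{k^*})$; (2) the assigned vehicle is replaced by the new one at $y_t$, i.e. $S^{t+1}=(s^t_1,\dots,s^t_{k^*-1},y_t,s^t_{k^*+1},\dots,s^t_N)$. The process $(S^t)_{t\ge1}$ is a homogeneous Markov chain on $X^N$. *)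

(* Defs.v *)
From HB Require Import structures.
From mathcomp Require Import all_boot all_order all_algebra finmap.
From mathcomp Require Import all_classical all_reals all_analysis.

Set Implicit Arguments.
Unset Strict Implicit.
Unset Printing Implicit Defensive.

Import Order.TTheory GRing.Theory Num.Theory.

Local Open Scope classical_set_scope.
Local Open Scope ring_scope.

(* The library's measurable types are pointed, so a space of this type is
   nonempty. The sigma-algebra is not tied to the metric here: theorems assume
   it to be the power set. *)
#[short(type="finMetricMeasurableType")]
HB.structure Definition FinMetricMeasurable (R : numDomainType)
    (d : measure_display) :=
  { X of Metric R X & Finite X & Measurable d X }.

Section independence.
Context d d' (T : measurableType d) (X : measurableType d') (R : realType).
Variable P : probability T R.

Definition has_law (Z : {RV P >-> X}) (mu : probability X R) : Prop :=
  forall A : set X, measurable A -> distribution P Z A = mu A.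

Definition mutually_independent (x : nat -> {RV P >-> X}) : Prop :=
  forall (J : {fset nat}) (A : nat -> set X),
    (forall t, t \in J -> measurable (A t)) ->
    P (\bigcap_(t in [set` J]) (x t @^-1` A t)) =
      (\prod_(t <- J) P (x t @^-1` A t))%E.

Definition iid (x : nat -> {RV P >-> X}) (mu : probability X R) : Prop :=
  mutually_independent x /\ forall t, has_law (x t) mu.

Definition sigma_of_sequence (x : nat -> {RV P >-> X}) : set (set T) :=
  <<s \bigcup_t preimage_set_system setT (x t) measurable >>.

Definition independent_sequences (x y : nat -> {RV P >-> X}) : Prop :=
  forall A B : set T, sigma_of_sequence x A -> sigma_of_sequence y B ->
    P (A `&` B) = (P A * P B)%E.

End independence.

Section greedy_matching.
Context (R : realType) (X : metricType R) (N : nat).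
Implicit Types (S : {ffun 'I_N -> X}) (kappa : {ffun 'I_N -> X} -> X -> 'I_N).

Definition closest_vehicle S (u : X) (k : 'I_N) : Prop :=
  forall j : 'I_N, mdist u (S k) <= mdist u (S j).

Definition greedy_rule kappa : Prop :=
  forall S (u : X), closest_vehicle S u (kappa S u).

Definition replace_vehicle S (k : 'I_N) (v : X) : {ffun 'I_N -> X} :=
  [ffun j => if j == k then v else S j].

(* Stages are numbered from 0: index t stands for stage t + 1 of the usual
   numbering, so [vehicles kappa S1 x y 0] is the initial tuple S1. *)
Fixpoint vehicles kappa (S1 : {ffun 'I_N -> X}) (x y : nat -> X) (t : nat)
    : {ffun 'I_N -> X} :=
  if t is t'.+1 then
    let S := vehicles kappa S1 x y t' in
    replace_vehicle S (kappa S (x t')) (y t')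
  else S1.

Definition cost kappa (S1 : {ffun 'I_N -> X}) (x y : nat -> X) (t : nat) : R :=
  let S := vehicles kappa S1 x y t in mdist (x t) (S (kappa S (x t))).

End greedy_matching.

(* Main.v *)
(* Given the history of the first [t] arrivals, the next pair of arrivals is an
   independent draw from [Q x P], so the expected cost at stage [t] is
   [(L^t f) S1], where [L] is the transition operator of the chain of fleets and
   [f S] is the expected cost of one stage started from [S]. Whatever the
   tie-breaking rule, a fixed number [N] of stages leads from every fleet to the
   one with all vehicles at a given point, with probability at least
   [eps = delta ^ N > 0]. This is Doeblin's condition: [L^N] shrinks the
   oscillation of any function by the factor [1 - eps], while the range of
   [L^t f] never grows, so [(L^t f) S1] is a Cauchy sequence. *)
Require Import Defs.
From HB Require Import structures.
From mathcomp Require Import all_boot all_order all_algebra finmap.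
From mathcomp Require Import all_classical all_reals all_analysis.
From mathcomp Require Import measurable_realfun lra.

Set Implicit Arguments.
Unset Strict Implicit.
Unset Printing Implicit Defensive.

Import Order.TTheory GRing.Theory Num.Theory.
Import numFieldNormedType.Exports.

Local Open Scope classical_set_scope.
Local Open Scope ring_scope.

(** * Doeblin contraction for averages along a random iteration *)

Section random_iteration.
Context (R : realType) (Omega : Type) (Z : finType).
Context (step : Omega -> Z -> Omega) (weight : Z -> R).
Implicit Types (g : Omega -> R) (S : Omega) (s : seq Z) (a b delta : R).

Definition transition g S : R := \sum_z weight z * g (step S z).

(** Turns lower bounds for [- g] into upper bounds for [g]. *)
Lemma iter_transitionN n g :
  iter n transition (fun S => - g S) = (fun S => - iter n transition g S).
Proof.
elim: n => //= n ->; apply/funext => S; rewrite /transition -sumrN.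
by apply: eq_bigr => z _; rewrite mulrN.
Qed.

Context (weight_sum1 : \sum_z weight z = 1).

Lemma transition_subr g a S :
  transition g S - a = \sum_z weight z * (g (step S z) - a).
Proof.
rewrite -[X in _ - X]mul1r -weight_sum1 mulr_suml -sumrB.
by apply: eq_bigr => z _; rewrite mulrBr.
Qed.

Context (delta : R) (delta_ge0 : 0 <= delta).
Context (delta_le : forall z, delta <= weight z).

Let weight_ge0 z : 0 <= weight z. Proof. exact: le_trans (delta_le z). Qed.

Lemma transition_ge g a : (forall S, a <= g S) ->
  forall S, a <= transition g S.
Proof.
move=> ag S; rewrite -subr_ge0 transition_subr sumr_ge0// => z _.
by rewrite mulr_ge0// subr_ge0.
Qed.

Lemma iter_transition_ge n g a : (forall S, a <= g S) ->
  forall S, a <= iter n transition g S.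
Proof. by move=> ag; elim: n => //= n; exact: transition_ge. Qed.

(** The draws spelling [s] have joint weight at least [delta ^+ size s]; all other outcomes
    contribute at least [a]. *)
Lemma iter_transition_ge_word g a s S : (forall S, a <= g S) ->
  a + delta ^+ size s * (g (foldl step S s) - a)
    <= iter (size s) transition g S.
Proof.
move=> ag; elim: s S => [|z s IHs] S /=; first by rewrite expr0 mul1r subrKC.
rewrite -lerBrDl transition_subr (bigD1 z)//= exprS -mulrA.
have Lge0 S' : 0 <= iter (size s) transition g S' - a.
  by rewrite subr_ge0; exact: iter_transition_ge.
rewrite -[leLHS]addr0 lerD//; last first.
  by apply: sumr_ge0 => z' _; rewrite mulr_ge0.
apply: ler_pM => //; last by rewrite lerBrDl.
by rewrite mulr_ge0 ?exprn_ge0// subr_ge0.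
Qed.

Context (N : nat) (S_ref : Omega).
Context (reach : forall S, exists2 s, size s = N & foldl step S s = S_ref).

(** Every [S] reaches the same [S_ref] by a word of the same length, so the single value [g S_ref]
    pulls both bounds towards it. *)
Lemma transition_contraction g a b : (forall S, a <= g S <= b) ->
  exists a' b', (forall S, a' <= iter N transition g S <= b') /\
                b' - a' = (1 - delta ^+ N) * (b - a).
Proof.
move=> gab.
exists (a + delta ^+ N * (g S_ref - a)), (b - delta ^+ N * (b - g S_ref)).
split; last by lra.
move=> S; have [s sN sS] := reach S; apply/andP; split.
  have := @iter_transition_ge_word g a s S.
  by rewrite sN sS; apply => S'; have /andP[] := gab S'.
have : forall S', - b <= - g S'.
  by move=> S'; rewrite lerN2; have /andP[] := gab S'.
move=> /iter_transition_ge_word-/(_ s S); rewrite iter_transitionN sN sS.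
by lra.
Qed.

Lemma iter_transition_cvg g a b S : 0 < delta -> delta <= 1 ->
  (forall S, a <= g S <= b) -> cvgn (fun n => iter n transition g S).
Proof.
move=> delta0 delta1 gab.
have bracket k : exists a' b',
    (forall S, a' <= iter (k * N) transition g S <= b') /\
    b' - a' = (1 - delta ^+ N) ^+ k * (b - a).
  elim: k => [|k [a' [b' [gab' ab']]]].
    by exists a, b; split => //; rewrite expr0 mul1r.
  have [a'' [b'' [gab'' ab'']]] := transition_contraction gab'.
  exists a'', b''; split; last by rewrite ab'' ab' exprS mulrA.
  by move=> S'; rewrite mulSn iterD.
have geo : (1 - delta ^+ N) ^+ k * (b - a) @[k --> \oo] --> (0 : R).
  rewrite -[0](mul0r (b - a)); apply: cvgMl; apply: cvg_expr.
  rewrite ger0_norm ?subr_ge0 ?exprn_ile1//.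
  by rewrite gtrBl exprn_gt0.
apply/cauchy_cvgP/cauchy_exP => e e0.
have [k ke] : exists k, (1 - delta ^+ N) ^+ k * (b - a) < e.
  have /cvgr_lt/(_ _ e0) [k _ ke] := geo.
  by exists k; apply: ke => /=.
have [a' [b' [gab' ab']]] := bracket k.
(* Later iterates keep the bounds [a'] and [b'], whose gap is below [e], so one ball around [a']
   contains the tail. *)
exists a'; exists (k * N)%N => // n /= kn.
rewrite -ball_normE /= distrC ger0_norm; last first.
  rewrite subr_ge0 -(subnK kn) iterD; apply: iter_transition_ge => S'.
  by have /andP[] := gab' S'.
apply: le_lt_trans ke; rewrite -ab' lerD2r -(subnK kn) iterD -lerN2.
have : forall S', - b' <= - iter (k * N) transition g S'.
  by move=> S'; rewrite lerN2; have /andP[] := gab' S'.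
by move=> /iter_transition_ge-/(_ (n - k * N)%N S); rewrite iter_transitionN.
Qed.

End random_iteration.

(** * Gathering all vehicles at one point *)

Section greedy_reachability.
Context (R : realType) (X : metricType R) (N : nat).
Context (kappa : {ffun 'I_N -> X} -> X -> 'I_N).
Implicit Types (S : {ffun 'I_N -> X}) (ab : X * X) (u : X).

Definition greedy_step S ab := replace_vehicle S (kappa S ab.1) ab.2.

Definition stage_cost S ab : R := mdist ab.1 (S (kappa S ab.1)).

Lemma vehicles_foldl S x y t :
  vehicles kappa S x y t =
  foldl greedy_step S (mkseq (fun i => (x i, y i)) t).
Proof. by elim: t => [//|t IHt]; rewrite mkseqS foldl_rcons /= -IHt. Qed.

Context (kappa_greedy : greedy_rule kappa).

(** Vehicle [j] is at distance 0 from this user, so the chosen vehicle is too. *)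
Lemma greedy_rule_occupied S j : S (kappa S (S j)) = S j.
Proof.
apply/esym/mdist_positivity/eqP; rewrite eq_le mdist_ge0 andbT.
by rewrite -[leRHS](mdistxx (S j)); exact: kappa_greedy.
Qed.

(* A user standing where a vehicle is takes a vehicle located there, so a
   vehicle away from [u] is moved to [u] by a user at its location followed by a
   driver at [u]. Once all vehicles are at [u], two arrivals at [u] change
   nothing, so the number of stages can be prescribed. *)
Lemma greedy_gather u n S : (#|[pred j | S j != u]| <= n)%N ->
  exists2 s, size s = n & foldl greedy_step S s = [ffun=> u].
Proof.
elim: n S => [|n IHn] S.
  rewrite leqn0 => /eqP/card0_eq Su; exists [::] => //=.
  by apply/ffunP => j; rewrite ffunE; apply/eqP; have /negbFE := Su j.
move=> Sn; pose v := if [pick j | S j != u] is Some j then S j else u.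
suff /IHn[s sn su] : (#|[pred j | greedy_step S (v, u) j != u]| <= n)%N.
  by exists ((v, u) :: s); rewrite /= ?sn.
rewrite /v; case: pickP => [j Sj|Su].
  have kj := greedy_rule_occupied S j; set k := kappa _ _ in kj.
  (* Vehicle [k] stood away from [u] and is moved there while the others stay, so the count
     drops. *)
  rewrite -ltnS (leq_trans _ Sn)// [X in (_ < X)%N](cardD1 k) inE kj Sj.
  rewrite add1n ltnS.
  apply/subset_leq_card/fintype.subsetP => i; rewrite !inE !ffunE /=.
  by case: (i =P k) => //=; rewrite eqxx.
rewrite (_ : #|_| = 0)%N//; apply: eq_card0 => i; rewrite !inE !ffunE.
by case: ifP; rewrite ?eqxx//; have := Su i.
Qed.

End greedy_reachability.

(** * Law of finite arrival histories and expected cost of a stage *)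

Section cylinders.
Context (R : realType) (dX : measure_display) (X : finMetricMeasurableType R dX).
Context (measurable_all : forall A : set X, measurable A).
Context (Q P : probability X R).
Context (dT : measure_display) (T : measurableType dT) (Pr : probability T R).
Context (x y : nat -> {RV Pr >-> X}).
Context (x_iid : iid x Q) (y_iid : iid y P) (xy_indep : independent_sequences x y).
Implicit Types (s : seq (X * X)) (ab : X * X).

Let arrivals (w : T) (i : nat) : X * X := (x i w, y i w).

Let history n (w : T) := mkseq (arrivals w) n.

Definition cylinder s : set T :=
  [set w | mkseq (fun i => (x i w, y i w)) (size s) = s].

Let coord_event (v : nat -> {RV Pr >-> X}) (a : nat -> X) n : set T :=
  \bigcap_(i in [set` [fset i in iota 0 n]%fset]) (v i @^-1` [set a i]).

(** Required by [independent_sequences]; viewing the generated sigma-algebra as a measurable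
    structure gives closure under finite intersections. *)
Let in_sigma v a n : sigma_of_sequence v (coord_event v a n).
Proof.
apply: (@fin_bigcap_measurable _
  (g_sigma_algebraType (\bigcup_t preimage_set_system setT (v t) measurable))).
  exact: finite_fset.
move=> i _; apply: sub_sigma_algebra; exists i => //.
by exists [set a i]; rewrite ?setTI.
Qed.

Let measurable_coord_event v a n : measurable (coord_event v a n).
Proof.
apply: fin_bigcap_measurable; first exact: finite_fset.
by move=> i _; rewrite -[_ @^-1` _]setTI; apply: measurable_funP.
Qed.

Let coord_event_prob v a n mu : iid v mu ->
  Pr (coord_event v a n) = (\prod_(0 <= i < n) mu [set a i])%E.
Proof.
case=> v_indep v_law; rewrite /coord_event v_indep//.
rewrite (perm_big (iota 0 n)); last first.
  by apply: uniq_perm; rewrite ?fset_uniq ?iota_uniq// => i; rewrite !inE.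
rewrite /index_iota subn0; apply: eq_bigr => i _.
by rewrite -(v_law i).
Qed.

(** Separating users from drivers lets independence of the two sequences apply first, then
    independence within each. The default [point] is never read. *)
Let cylinderE s : cylinder s =
  coord_event x (fun i => (nth point s i).1) (size s) `&`
  coord_event y (fun i => (nth point s i).2) (size s).
Proof.
apply/seteqP; split => w /=.
  move=> ws; split => i /=; rewrite !inE mem_iota /= => ilt;
    by rewrite -[in RHS]ws nth_mkseq.
move=> [xs ys]; apply: (@eq_from_nth _ point); rewrite size_mkseq// => i ilt.
have iJ : (i \in [fset i in iota 0 (size s)])%fset by rewrite !inE mem_iota.
rewrite nth_mkseq// [RHS]surjective_pairing.
by rewrite -(xs i iJ) -(ys i iJ).
Qed.

Lemma measurable_cylinder s : measurable (cylinder s).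
Proof. by rewrite cylinderE; exact: measurableI. Qed.

Lemma cylinder_prob s :
  Pr (cylinder s) = (\prod_(ab <- s) (Q [set ab.1%PAIR] * P [set ab.2%PAIR]))%E.
Proof.
rewrite cylinderE xy_indep// (coord_event_prob _ _ x_iid).
by rewrite (coord_event_prob _ _ y_iid) [RHS](big_nth point) big_split.
Qed.

Definition arrival_weight ab : R :=
  fine (Q [set ab.1%PAIR]) * fine (P [set ab.2%PAIR]).

Lemma cylinder_prob_rcons s ab :
  Pr (cylinder (rcons s ab)) = (Pr (cylinder s) * (arrival_weight ab)%:E)%E.
Proof.
rewrite !cylinder_prob big_rcons /=.
by rewrite EFinM !fineK ?fin_num_measure.
Qed.

(** Finite sequences over a finite set are countably many, so the preimage is a countable union of
    cylinders. *)
Lemma measurable_fun_history n (phi : seq (X * X) -> R) :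
  measurable_fun setT (fun w => phi (history n w)).
Proof.
move=> _ B mB; rewrite setTI.
rewrite (_ : _ @^-1` _ =
  \bigcup_(s in [set s | size s = n /\ B (phi s)]) cylinder s); last first.
  apply/seteqP; split => w /=; last by case=> s [<- ?] /= ws; rewrite /history ws.
  by move=> Bw; exists (history n w) => //=; rewrite /cylinder/= size_mkseq.
rewrite bigcup_mkcond; apply: countable_bigcupT_measurable => // s.
by case: ifP => // _; exact: measurable_cylinder.
Qed.

(** The value of the next arrival pair partitions the cylinder. *)
Lemma integral_cylinder_rcons s (f : T -> \bar R) : measurable_fun setT f ->
  (forall w, (0 <= f w)%E) ->
  (\int[Pr]_(w in cylinder s) f w =
   \sum_ab \int[Pr]_(w in cylinder (rcons s ab)) f w)%E.
Proof.
move=> mf f0; rewrite -ge0_integral_bigsetU//=; first last.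
- exact: measurable_funTS.
- move=> ab ab' _ _ [w []]; rewrite /cylinder/= !size_rcons => ->.
  by move=> /rcons_inj[].
- exact: index_enum_uniq.
- by move=> ab; exact: measurable_cylinder.
congr integral; rewrite -bigcup_seq; apply/seteqP; split => w /=.
  move=> ws; exists (arrivals w (size s)); first by rewrite /= mem_index_enum.
  by rewrite /cylinder/= size_rcons mkseqS; congr rcons.
by case=> ab _; rewrite /cylinder/= size_rcons mkseqS => /rcons_inj[].
Qed.

Lemma cylinder_nil : cylinder [::] = setT.
Proof. by apply/seteqP; split. Qed.

Lemma arrival_weight_sum1 : \sum_ab arrival_weight ab = 1.
Proof.
have := @integral_cylinder_rcons [::] (cst 1%E) (measurable_cst _).
rewrite integral_cst/=; last exact: measurable_cylinder.
rewrite cylinder_nil probability_setT mule1 => /(_ (fun=> lee01)) sum1.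
apply: EFin_inj; rewrite [RHS]sum1 -sumEFin; apply: eq_bigr => ab _.
rewrite integral_cst/=; last exact: measurable_cylinder.
by rewrite (cylinder_prob_rcons [::]) cylinder_nil probability_setT !mul1e.
Qed.

Context (Omega : Type) (step : Omega -> X * X -> Omega).
Context (c : Omega -> X * X -> R) (c_ge0 : forall S ab, 0 <= c S ab) (S1 : Omega).

Let run_cost n w := c (foldl step S1 (history n w)) (arrivals w n).

Let measurable_run_cost n : measurable_fun setT (run_cost n).
Proof.
(* The cost at index [n] depends on [n.+1] pairs: the first [n] give the state, the last one is the
   current arrival. *)
pose phi h := c (foldl step S1 (take n h)) (nth point h n).
have -> : run_cost n = fun w => phi (history n.+1 w).
  apply/funext => w; rewrite /run_cost /phi /history mkseqS.
  by rewrite -cats1 take_size_cat ?size_mkseq// nth_cat size_mkseq ltnn subnn.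
exact: (measurable_fun_history n.+1 phi).
Qed.

Let mean_cost S : R := \sum_ab arrival_weight ab * c S ab.

(** Markov property in integrated form: after the history [s], later arrivals act as fresh draws.
    All [s] are covered because the induction on [n] lengthens [s]. *)
Lemma integral_cylinder_run n s :
  (\int[Pr]_(w in cylinder s) (run_cost (size s + n) w)%:E =
   Pr (cylinder s) *
   (iter n (transition step arrival_weight) mean_cost (foldl step S1 s))%:E)%E.
Proof.
have prE s' : Pr (cylinder s') = (fine (Pr (cylinder s')))%:E.
  by rewrite fineK// fin_num_measure//; exact: measurable_cylinder.
elim: n s => [|n IHn] s; (rewrite integral_cylinder_rcons;
  [|exact/measurable_EFinP|by move=> w; rewrite lee_fin; exact: c_ge0]).
  (* On the cylinder of [rcons s ab] the integrand is the constant [c (foldl step S1 s) ab]. *)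
  rewrite addn0 [in RHS]prE -EFinM mulr_sumr -sumEFin; apply: eq_bigr => ab _.
  rewrite mulrA 2!EFinM -prE -cylinder_prob_rcons muleC.
  rewrite -integral_cst; last exact: measurable_cylinder.
  apply: eq_integral => w; rewrite inE /cylinder /= size_rcons mkseqS.
  by move=> /rcons_inj[ws wab]; rewrite /run_cost /history ws /arrivals wab.
rewrite iterS {1}/transition [in RHS]prE -EFinM mulr_sumr -sumEFin.
apply: eq_bigr => ab _; rewrite mulrA 2!EFinM -prE -cylinder_prob_rcons.
by rewrite -foldl_rcons -IHn size_rcons addnS.
Qed.

End cylinders.

Theorem theorem1 (R : realType)
  (dX : measure_display) (X : finMetricMeasurableType R dX)
  (hX : forall A : set X, measurable A)
  (N : nat) (hN : (1 <= N)%N)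
  (kappa : {ffun 'I_N -> X} -> X -> 'I_N) (hkappa : greedy_rule kappa)
  (Q P : probability X R)
  (hQ : forall u : X, (0%E < Q [set u])%E)
  (hP : forall u : X, (0%E < P [set u])%E)
  (dT : measure_display) (T : measurableType dT) (Pr : probability T R)
  (x y : nat -> {RV Pr >-> X})
  (hx : iid x Q) (hy : iid y P)
  (hxy : independent_sequences x y)
  (S1 : {ffun 'I_N -> X}) :
  exists l : R,
    ('E_Pr[fun w : T => cost kappa S1 (x ^~ w) (y ^~ w) t])%E
      @[t --> \oo] --> l%:E.
Proof.
pose weight : X * X -> R := arrival_weight Q P.
pose mean_cost S := \sum_ab weight ab * stage_cost kappa S ab.
(* A minimum of finitely many positive weights; starting it at 1 gives [delta <= 1] at once. *)
pose delta := \big[Num.min/1]_ab weight ab.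
have weight_gt0 ab : 0 < weight ab.
  by rewrite mulr_gt0// fine_gt0// (hQ, hP) ltey_eq fin_num_measure.
have cost_ge0 S ab : 0 <= stage_cost kappa S ab by exact: mdist_ge0.
have mean_cost_ge0 S : 0 <= mean_cost S.
  by apply: sumr_ge0 => ab _; rewrite mulr_ge0// ltW.
have delta_gt0 : 0 < delta by exact: lt_bigmin.
have /cvg_ex[l costl] : cvgn (fun n =>
    iter n (transition (greedy_step kappa) weight) mean_cost S1).
  (* At most [N] vehicles are away from [point], so [N] stages can gather them. The sum of the
     nonnegative mean costs over the finitely many fleets bounds each one. *)
  apply: (@iter_transition_cvg _ _ _ _ _ (arrival_weight_sum1 hX hx hy hxy)
    delta (ltW delta_gt0) _ N [ffun=> point] _ _ 0 (\sum_S mean_cost S)) => //.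
  - by move=> ab; exact: bigmin_le.
  - move=> S; apply: greedy_gather => //.
    by rewrite (leq_trans (max_card _))// card_ord.
  - exact: bigmin_le_id.
  - by move=> S; rewrite mean_cost_ge0 (bigD1 S)//= lerDl sumr_ge0.
exists l.
rewrite (_ : (fun t => _) = fun t => (iter t (transition (greedy_step kappa)
    weight) mean_cost S1)%:E); first exact: cvg_EFin (nearW _ _) costl.
apply/funext => t; rewrite unlock.
transitivity (\int[Pr]_(w in cylinder x y [::])
    (stage_cost kappa (foldl (greedy_step kappa) S1
      (mkseq (fun i => (x i w, y i w)) t)) (x t w, y t w))%:E)%E.
  rewrite cylinder_nil; apply: eq_integral => w _.
  by rewrite /cost vehicles_foldl.
rewrite (integral_cylinder_run hX hx hy hxy (greedy_step kappa) cost_ge0 S1 t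
  [::]).
by rewrite cylinder_nil probability_setT mul1e.
Qed.
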